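(* Let $f:E\to\mathbb{R}$ be a convex, differentiable function whose gradient is $L$-Lipschitz, with $L>0$, and assume that $f$ admits a minimizer. Let $0<\gamma<\frac{2}{L}$. Then for every $x_0\in E$, the sequence defined for all $n\in\mathbb{N}$ by $x_{n+1}=x_n-\gamma\nabla f(x_n)$ converges to a minimizer of $f$.
   Context: $E$ is a finite-dimensional Euclidean space with inner product $\langle\cdot,\cdot\rangle$ and associated norm $\|\cdot\|$. The gradient of $f$ is $L$-Lipschitz if $\|\nabla f(x)-\nabla f(y)\|\le L\|x-y\|$ for all $x,y\in E$. *)

(* Defs.v *)
From HB Require Import structures.
From mathcomp Require Import all_boot all_order all_algebra.
From mathcomp Require Import boolp classical_sets functions reals topology.
From mathcomp Require Import tvs normedtype convex derive sequences.

Set Implicit Arguments.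
Unset Strict Implicit.
Unset Printing Implicit Defensive.

Import Order.TTheory GRing.Theory Num.Theory.
Import numFieldNormedType.Exports.

Local Open Scope classical_set_scope.
Local Open Scope ring_scope.

(* Finite dimension comes from [Vector]. The topology of a [NormedModule] is
   the one of its norm, so [euclid_normE] makes both of them Euclidean. *)
HB.mixin Record isEuclidean (R : realType) (E : Type)
    of NormedModule R E & Vector R E := {
  inner : {dot E for (@idfun R)} ;
  euclid_normE : forall x : E, `|x| = Num.sqrt (inner x x)
}.

#[short(type="euclideanType")]
HB.structure Definition Euclidean (R : realType) :=
  {E of NormedModule R E & Vector R E & isEuclidean R E}.

(* The Riesz representative of the differential of [f] at [x]; by [gradientP]
   the default value [0] is never reached. *)
Definition gradient (R : realType) (E : euclideanType R) (f : E -> R) (x : E) :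
    E :=
  xget 0 [set g : E | forall h : E, 'd f x h = inner g h].

Definition minimizer (R : realType) (E : Type) (f : E -> R) (x : E) : Prop :=
  forall y : E, f x <= f y.

Lemma riesz (R : realType) (E : euclideanType R) (phi : {linear E -> R^o}) :
  exists g : E, forall h : E, phi h = inner g h.
Proof.
pose F (g : E) : 'Hom(E, R^o) := linfun (inner g : E -> R^o).
have FE g h : F g h = inner g h by rewrite lfunE.
have linF : linear F.
  by move=> a u v; apply/lfunP => h; rewrite !lfunE /= lfunE /= !lfunE /= linearPl.
pose FL : {linear E -> 'Hom(E, R^o)} :=
  HB.pack F (GRing.isLinear.Build R E 'Hom(E, R^o) *:%R F linF).
have injF : lker (linfun FL) == 0%VS.
  apply/eqP/vspaceP => g; rewrite memv_ker memv0 lfunE /=.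
  apply/eqP/eqP => [/lfunP/(_ g)|]; last by move=> ->; apply: (linear0 FL).
  rewrite FE zero_lfunE => gg; apply/eqP; apply: contraTT isT => g0.
  by have := neq0_dnorm_gt0 (s := inner) g g0; rewrite gg ltxx.
have : limg (linfun FL) == fullv.
  by rewrite eqEdim subvf limg_dim_eq ?(eqP injF) ?capv0// !dimvf /dim /= muln1.
move=> /eqP imF; have : linfun phi \in limg (linfun FL) by rewrite imF memvf.
move=> /memv_imgP[g _ phiE]; exists g => h.
by rewrite -FE -[phi h](lfunE phi) phiE lfunE.
Qed.

Lemma gradientP (R : realType) (E : euclideanType R) (f : E -> R) (x h : E) :
  'd f x h = inner (gradient f x) h.
Proof.
rewrite /gradient; case: xgetP => [g _ //|/=].
by have [g gE] := riesz ('d f x) => /(_ g)/(_ gE).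
Qed.

(* Main.v *)
(* A convex [f] with [L]-Lipschitz gradient has a [1/L]-cocoercive gradient.
   Hence a gradient step brings the iterate closer to every minimizer, the
   squared distance dropping by at least [gamma (2 / L - gamma) |gradient|^2].
   So the gradients tend to [0] along the iterates, which are bounded and have
   a cluster point [p]; by continuity [gradient f p = 0] and [p] is a minimizer.
   The distance to [p] is then nonincreasing and arbitrarily small at some
   indices, so the whole sequence converges to [p]. *)
Require Import Defs.
From HB Require Import structures.
From mathcomp Require Import all_boot all_order all_algebra.
From mathcomp Require Import boolp classical_sets functions reals topology.
From mathcomp Require Import tvs normedtype convex derive sequences.
From mathcomp Require Import interval_inference ring lra.
Set Implicit Arguments.
Unset Strict Implicit.
Unset Printing Implicit Defensive.
Import Order.TTheory GRing.Theory Num.Theory.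
Import numFieldNormedType.Exports.
Local Open Scope classical_set_scope.
Local Open Scope ring_scope.

(** * Norm identities and the Cauchy-Schwarz inequality *)

Section inner_product.
Context {R : realType} {E : euclideanType R}.
Implicit Types (u v w : E) (a : R).

Lemma innerC u v : inner u v = inner v u.
Proof. by rewrite hermC expr0 mul1r. Qed.

Lemma innerZr a u v : inner u (a *: v) = a * inner u v.
Proof. by rewrite linearZr. Qed.

Lemma innerZl a u v : inner (a *: u) v = a * inner u v.
Proof. by rewrite innerC innerZr innerC. Qed.

Lemma innerBl u v w : inner (u - v) w = inner u w - inner v w.
Proof. by rewrite linearBl. Qed.

Lemma innerBr u v w : inner u (v - w) = inner u v - inner u w.
Proof. by rewrite linearBr. Qed.

Lemma innerNr u v : inner u (- v) = - inner u v.
Proof. by rewrite linearNr. Qed.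

Lemma inner_ge0 u : 0 <= inner u u.
Proof.
have [->|u0] := eqVneq u 0; first by rewrite linear0r.
exact/ltW/neq0_dnorm_gt0.
Qed.

Lemma innerE u : inner u u = `|u| ^+ 2.
Proof. by rewrite euclid_normE sqr_sqrtr ?inner_ge0. Qed.

Lemma sqr_normB u v : `|u - v| ^+ 2 = `|u| ^+ 2 - inner u v *+ 2 + `|v| ^+ 2.
Proof. by rewrite -!innerE innerBl !innerBr (innerC v u); ring. Qed.

(** For nonzero vectors, the squared norm of [|v| *: u - |u| *: v] is nonnegative and factors as
    [2 |u| |v| (|u| |v| - inner u v)]. *)
Lemma inner_le u v : inner u v <= `|u| * `|v|.
Proof.
have [->|u0] := eqVneq u 0; first by rewrite linear0l normr0 mul0r.
have [->|v0] := eqVneq v 0; first by rewrite linear0r normr0 mulr0.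
have := sqr_ge0 `| `|v| *: u - `|u| *: v|.
rewrite sqr_normB !normrZ !normr_id innerZl innerZr.
have : 0 < `|u| * `|v| by rewrite mulr_gt0 ?normr_gt0.
move: `|u| `|v| (inner u v) => a b c ab.
rewrite [_ + _](_ : _ = (2 * (a * b)) * (a * b - c)); last by ring.
by rewrite pmulr_rge0 ?subr_ge0// pmulr_rgt0.
Qed.

Lemma norm_inner_le u v : `|inner u v| <= `|u| * `|v|.
Proof.
by rewrite ler_norml inner_le andbT lerNl -(mulN1r (inner u v)) -innerZl
  scaleN1r -(normrN u) inner_le.
Qed.

End inner_product.

(* By [riesz] the coordinates are inner products with fixed vectors, so those
   of a bounded sequence stay in a compact box. *)
Lemma bounded_seq_cluster (R : realType) (E : euclideanType R) (x : nat -> E)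
    (M : R) : (forall n, `|x n| <= M) ->
  exists p : E, forall (e : R) (N : nat), 0 < e ->
    exists2 n, (N <= n)%N & `|x n - p| < e.
Proof.
move=> xM; pose b := vbasis {: E}.
pose c i : {linear E -> R^o} := coord b i.
have [g gE] := choice (fun i => riesz (c i)).
pose y n : 'rV[R]_(\dim {: E}) := \row_i c i (x n).
pose I i := `[- (`|g i| * M), `|g i| * M].
have yI n i : y n ord0 i \in I i.
  rewrite mxE gE in_itv /= -ler_norml.
  by rewrite (le_trans (norm_inner_le _ _))// ler_wpM2l.
have cI := @rV_compact R _ (fun i => [set` I i])
  (fun i => @segment_compact R _ _).
have [|q [_ qcl]] := cI (y @ \oo) _; first by exists 0%N => // n _ i; exact: yI.
exists (\sum_i q ord0 i *: b`_i) => e N e0.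
(* The [1] keeps [B] positive even if the sum is empty, and makes the total error strictly less than
   [e] once each coordinate is within [e / B] of that of [q]. *)
pose B := 1 + \sum_(i < \dim {: E}) `|b`_i|.
have B0 : 0 < B by rewrite ltr_pwDl// sumr_ge0.
have [] := qcl (y @` [set n | (N <= n)%N]) (ball q (e / B)).
- by exists N => // n /= Nn; exists n.
- by apply: nbhsx_ballx; rewrite divr_gt0.
move=> _ [[n /= Nn <-]] [_ qy]; exists n => //.
rewrite {1}(coord_basis (vbasisP {: E}) (memvf (x n))) -sumrB.
apply: (@le_lt_trans _ _ (e / B * \sum_(i < \dim {: E}) `|b`_i|)).
  rewrite (le_trans (ler_norm_sum _ _ _))// mulr_sumr ler_sum// => i _.
  rewrite -scalerBl normrZ ler_wpM2r// distrC ltW//.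
  by have := qy ord0 i; rewrite mxE.
by rewrite -mulrA gtr_pMr// mulrC ltr_pdivrMr// mul1r ltrDr.
Qed.

(** * First-order inequalities for convex and smooth functions *)

Section gradient_inequalities.
Context {R : realType} {E : euclideanType R} (f : E -> R).
Hypothesis f_diff : forall x : E, differentiable f x.

(** The difference quotient at [t] is that of [f] at [x + t *: d] in the direction [d]. *)
Lemma is_derive_line (x d : E) (t : R) :
  is_derive t 1 (fun s : R => f (x + s *: d))
    (inner (gradient f (x + t *: d)) d).
Proof.
have dq : (fun h : R => h^-1 *: (f (x + (h *: (1 : R) + t) *: d) -
      f (x + t *: d))) =
    (fun h => h^-1 *: ((f \o shift (x + t *: d)) (h *: d) - f (x + t *: d))).
  apply/funext => h /=; congr (_ *: (f _ - _)).
  by rewrite [_%:A]mulr1 scalerDl addrCA.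
have := @diff_derivable _ _ _ f _ d (f_diff (x + t *: d)).
have := deriveE d (f_diff (x + t *: d)).
rewrite gradientP /derive /derivable -dq => <- cv.
by split.
Qed.

(** Convexity bounds the difference quotients of [f] at [x] towards [y] by [f y - f x] for steps
    [0 < h <= 1]; let [h] tend to [0] from the right. *)
Lemma convex_gradient_le (f_convex : convex_function setT f) (x y : E) :
  f x + inner (gradient f x) (y - x) <= f y.
Proof.
rewrite addrC -lerBrDr -gradientP -deriveE//.
have /cvg_dnbhs_at_right := @diff_derivable _ _ _ f _ (y - x) (f_diff x).
move/cvgr_to_le; apply.
near=> h.
have h0 : 0 < h by [].
have h1 : h <= 1 by near: h; exact: nbhs_right_le.
have fh : f (h *: y + (1 - h) *: x) <= h * f y + (1 - h) * f x :=
  f_convex (Itv01 (ltW h0) h1) y x (mem_set I) (mem_set I).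
rewrite [_ *: _]mulrC ler_pdivrMr// lerBlDr.
rewrite /=; have -> : h *: (y - x) + x = h *: y + (1 - h) *: x.
  by rewrite scalerBr scalerBl scale1r -addrA (addrC (- _)).
by rewrite [leRHS](_ : _ = h * f y + (1 - h) * f x)//; ring.
Unshelve. all: by end_near. Qed.

Lemma gradient0_minimizer (f_convex : convex_function setT f) (z : E) :
  gradient f z = 0 -> minimizer f z.
Proof.
move=> gz y; have := convex_gradient_le f_convex z y.
by rewrite gz linear0l addr0.
Qed.

Section smooth.
Context (L : R).
Hypotheses (L_gt0 : 0 < L) (f_smooth : L.-lipschitz (gradient f)).

Lemma gradient_lipschitz (x y : E) :
  `|gradient f x - gradient f y| <= L * `|x - y|.
Proof. by have /= := f_smooth (_ : (setT `*` setT) (x, y)); exact. Qed.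

Lemma descent_lemma (x y : E) :
  f y <= f x + inner (gradient f x) (y - x) + L / 2 * `|y - x| ^+ 2.
Proof.
set d := y - x.
pose a := inner (gradient f x) d; pose b := L / 2 * `|d| ^+ 2.
(* Up to a constant, [phi] is [f] on the segment minus its quadratic model. By Cauchy-Schwarz and
   the Lipschitz bound its derivative is at most [L t |d|^2 - 2 b t = 0]. *)
pose phi : R -> R :=
  (fun s => f (x + s *: d)) - (fun s => a * s) - (fun s => b * s ^+ 2).
have dphi (t : R) : is_derive t (1 : R) phi
    (inner (gradient f (x + t *: d)) d - a - b * (t *+ 2)).
  have dline := is_derive_line x d t.
  apply: is_derive_eq.
  by rewrite !scaler1.
have : phi 1 <= phi 0.
  apply: (@ler0_derive1_le_cc _ phi 0 1) => //; rewrite ?in_itv/= ?lexx ?ler01//.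
  - move=> t /itvP t01; rewrite derive1E derive_val /a -innerBl.
    rewrite subr_le0 (le_trans (inner_le _ _))//.
    have := gradient_lipschitz (x + t *: d) x.
    rewrite addrAC subrr add0r normrZ ger0_norm ?t01// => gL.
    rewrite (le_trans (ler_wpM2r _ gL))// /b.
    by rewrite le_eqVlt; apply/orP; left; apply/eqP; field.
  - by apply: derivable_within_continuous => t _; exact: ex_derive.
rewrite /phi !fctE scale1r scale0r addr0 [x + _]addrC subrK.
by rewrite -/a -/b; lra.
Qed.

(* The tangent at [x] lies below [f] and the quadratic model at [y] above it;
   they are compared at [y - L^-1 *: g], where [g] is the gradient gap. *)
Lemma cocoercive_gap (f_convex : convex_function setT f) (x y : E) :
  f x - f y <= inner (gradient f x) (x - y)
    - (2 * L)^-1 * `|gradient f y - gradient f x| ^+ 2.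
Proof.
set g := gradient f y - gradient f x.
have := convex_gradient_le f_convex x (y - L^-1 *: g).
have := descent_lemma y (y - L^-1 *: g).
have -> : y - L^-1 *: g - y = - (L^-1 *: g) by rewrite addrAC subrr add0r.
rewrite normrN normrZ exprMn gtr0_norm ?invr_gt0//.
rewrite (addrAC y) -(opprB x y) (innerBr _ (- (x - y))) !innerNr !innerZr.
have : inner g g = `|g| ^+ 2 by rewrite innerE.
rewrite {1}/g innerBl.
move: (inner _ g) (inner _ g) (`|g| ^+ 2) => v u w <- le1 le2.
(* Here [u - v] is [|g|^2]; the gain [1 / L] of the linear terms loses [1 / (2 L)] to the quadratic
   one. *)
have -> : (2 * L)^-1 * (u - v) = L^-1 * (u - v) - L / 2 * (L^-1 ^+ 2 * (u - v)).
  by field; exact: lt0r_neq0.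
by lra.
Qed.

(** Adding [cocoercive_gap] for both orders of the points cancels the values of [f]. *)
Lemma gradient_cocoercive (f_convex : convex_function setT f) (x y : E) :
  L^-1 * `|gradient f x - gradient f y| ^+ 2 <=
    inner (gradient f x - gradient f y) (x - y).
Proof.
have := cocoercive_gap f_convex x y; have := cocoercive_gap f_convex y x.
rewrite innerBl -(opprB x y) innerNr -(normrN (gradient f y - _)) opprB.
have -> (a : R) : L^-1 * a = (2 * L)^-1 * a + (2 * L)^-1 * a.
  by field; exact: lt0r_neq0.
by lra.
Qed.

(* A gradient step of length [L^-1] decreases [f] by [`|gradient f z|^2 / (2 L)]. *)
Lemma minimizer_gradient0 (z : E) : minimizer f z -> gradient f z = 0.
Proof.
move=> zmin; apply/eqP; rewrite -normr_eq0 -sqrf_eq0 eq_le sqr_ge0 andbT.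
have := le_trans (zmin _) (descent_lemma z (z - L^-1 *: gradient f z)).
have -> : z - L^-1 *: gradient f z - z = - (L^-1 *: gradient f z).
  by rewrite addrAC subrr add0r.
rewrite normrN normrZ exprMn gtr0_norm ?invr_gt0// innerNr innerZr innerE -addrA lerDl.
have -> (a : R) : - (L^-1 * a) + L / 2 * (L^-1 ^+ 2 * a) = - ((2 * L)^-1 * a).
  by field; exact: lt0r_neq0.
by rewrite oppr_ge0 pmulr_rle0// invr_gt0 mulr_gt0.
Qed.

(** Expand the square: since the gradient vanishes at [z], cocoercivity bounds the cross term by
    [- 2 gamma / L |gradient f x|^2]. *)
Lemma gradient_step_dist (f_convex : convex_function setT f) (gamma : R)
    (x z : E) : 0 <= gamma -> minimizer f z ->
  `|x - gamma *: gradient f x - z| ^+ 2 +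
    gamma * (2 / L - gamma) * `|gradient f x| ^+ 2 <= `|x - z| ^+ 2.
Proof.
move=> gamma0 /minimizer_gradient0 gz.
have := gradient_cocoercive f_convex x z; rewrite gz subr0 => coco.
have -> : x - gamma *: gradient f x - z = (x - z) - gamma *: gradient f x.
  by rewrite addrAC.
rewrite sqr_normB normrZ exprMn ger0_norm// innerZr innerC.
by have := ler_wpM2l gamma0 coco; lra.
Qed.

End smooth.
End gradient_inequalities.

Theorem theorem1 (R : realType) (E : euclideanType R) (f : E -> R) (L gamma : R)
  (f_convex : convex_function setT f)
  (f_diff : forall x : E, differentiable f x)
  (L_gt0 : 0 < L)
  (f_smooth : L.-lipschitz (gradient f))
  (f_min : exists xmin : E, minimizer f xmin)
  (gamma_gt0 : 0 < gamma) (gamma_lt : gamma < 2 / L)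
  (x0 : E) (x : nat -> E)
  (x_init : x 0%N = x0)
  (x_step : forall n : nat, x n.+1 = x n - gamma *: gradient f (x n)) :
  exists2 xstar : E, minimizer f xstar & x @ \oo --> xstar.

Proof.
have [z zmin] := f_min.
pose c := gamma * (2 / L - gamma).
have c0 : 0 < c by rewrite mulr_gt0 ?subr_gt0.
have fejer w n : minimizer f w -> `|x n.+1 - w| ^+ 2 +
    c * `|gradient f (x n)| ^+ 2 <= `|x n - w| ^+ 2.
  by rewrite x_step; apply: gradient_step_dist => //; exact: ltW.
have dist_step w n : minimizer f w -> `|x n.+1 - w| <= `|x n - w|.
  move=> wmin; rewrite -ler_sqr ?nnegrE// (le_trans _ (fejer w n wmin))//.
  by rewrite lerDl mulr_ge0 ?sqr_ge0// ltW.
have dist_ninc w : minimizer f w -> nonincreasing_seq (fun n => `|x n - w|).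
  by move=> wmin; apply/nonincreasing_seqP => n; exact: dist_step.
have [|p p_cluster] := @bounded_seq_cluster R E x (`|x 0%N - z| + `|z|).
  move=> n; rewrite -{1}(subrK z (x n)) (le_trans (ler_normD _ _))// lerD2r.
  exact: dist_ninc.
(* The squared distances to [z] decrease and converge, so their successive drops, which dominate
   [c |gradient f (x n)|^2], tend to [0]. *)
have grad_cvg : `|gradient f (x n)| ^+ 2 @[n --> \oo] --> (0 : R).
  pose u n := `|x n - z| ^+ 2.
  have u_cvg : cvgn u.
    apply: nonincreasing_is_cvgn; last by exists 0 => _ [n _ <-]; exact: sqr_ge0.
    by move=> m n mn; rewrite ler_sqr ?nnegrE//; exact: dist_ninc.
  have du : c^-1 * (u n - u n.+1) @[n --> \oo] --> (0 : R).
    rewrite -(mulr0 c^-1) -(subrr (limn u)); apply: cvgMr; apply: cvgB => //.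
    by rewrite (cvg_shiftS u).
  apply: squeeze_cvgr (cvg_cst 0) du; apply: nearW => n.
  rewrite sqr_ge0 ler_pdivlMl// lerBrDl; exact: fejer.
have gp : gradient f p = 0.
  apply/eqP; rewrite -normr_le0; apply/ler_addgt0Pl => e e0.
  (* Past [N] the gradients are below [e / 2]; an iterate past [N] within [e / 2 / L] of [p] changes
     the gradient by less than [e / 2]. *)
  have e20 : 0 < e / 2 by rewrite divr_gt0.
  have /cvgr_lt /(_ ((e / 2) ^+ 2)) [|N _ gN] := grad_cvg.
    by rewrite exprn_gt0.
  have [n Nn xp] := p_cluster (e / 2 / L) N (divr_gt0 e20 L_gt0).
  have gx : `|gradient f (x n)| < e / 2.
    by rewrite -ltr_sqr ?nnegrE ?(ltW e20)//; exact: gN.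
  have := gradient_lipschitz f_smooth p (x n).
  rewrite distrC in xp; move: xp; rewrite ltr_pdivlMr// mulrC => xp gL.
  have := ler_normD (gradient f p - gradient f (x n)) (gradient f (x n)).
  by rewrite subrK; lra.
have pmin := gradient0_minimizer f_diff f_convex gp.
exists p => //; apply/cvgrPdist_lt => e e0.
(* One iterate close to [p] suffices, as later ones are no farther. *)
have [N _ xN] := p_cluster e 0%N e0.
exists N => // n /= Nn; rewrite distrC.
exact: le_lt_trans (dist_ninc p pmin _ _ Nn) xN.
Qed.
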